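(* Both $C(s)$ and $C_0(s)$ are asymptotic to $2s^{2s}$ as $s\to\infty$; that is, $$\lim_{s\to\infty}\frac{C(s)}{2s^{2s}}=1\qquad\text{and}\qquad \lim_{s\to\infty}\frac{C_0(s)}{2s^{2s}}=1.$$
   Context: The function $B(m,n,h)$ of nonnegative integers $m,n,h$ with $h\le n$ is defined by recursion on $h$: $B(m,n,0)=m+mn=m(n+1)$, and for $h\ge 1$ $$B(m,n,h)=(m+h)(n^3+n^2+n+1)+h(n+1)+B\bigl((m+h)n^2,\,n,\,h-1\bigr).$$ For a positive integer $s$, $C(s)$ is the largest value of $B(m,n,h)+h$ over nonnegative integers $m,n,h$ with $m+n=s$ and $0\le h\le n-1$, and $C_0(s)$ is the largest value of $B(0,n,h)+m+h$ over nonnegative integers $m,n,h$ with $m+n=s$ and $0\le h\le n-1$. *)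

(* Defs.v *)
From mathcomp Require Import all_boot.

Set Implicit Arguments.
Unset Strict Implicit.
Unset Printing Implicit Defensive.

(* Total in all three arguments; only the values with h <= n are meaningful.
   The first argument varies in the recursion on h. *)
Fixpoint B (m n h : nat) {struct h} : nat :=
  if h is h'.+1 then
    (m + h) * (n ^ 3 + n ^ 2 + n + 1) + h * (n + 1) + B ((m + h) * n ^ 2) n h'
  else m + m * n.

(* The pairs (m, n) with m + n = s are the pairs (s - n, n) with n <= s, and
   0 <= h <= n - 1 is h < n (so n = 0 contributes no triple).  For s > 0 the
   triple (0, s, 0) is admissible, so this maximum is over a nonempty range. *)
Definition C (s : nat) : nat :=
  \max_(n < s.+1) \max_(h < n) (B (s - n) n h + h).

Definition C0 (s : nat) : nat :=
  \max_(n < s.+1) \max_(h < n) (B 0 n h + (s - n) + h).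

(* Main.v *)
Require Import Defs.
From mathcomp Require Import all_boot all_order all_algebra.
From mathcomp Require Import all_classical all_reals all_analysis.
From mathcomp Require Import zify ring lra.
Import Order.TTheory GRing.Theory Num.Theory.
Import numFieldNormedType.Exports.

(* Unrolling the recursion gives, with q = n^2 and g_j = 1 + q + ... + q^j,
   B(m,n,h) + (n+1)m = 2(n+1)(m g_h + sum_(j <= h) j g_j), whence
   (q-1)^2 B(m,n,h) <= 2(n+1)(m+h) q^(h+2).  For n = s and h = s-1 the sum
   is at least 2(s^2-1) s^(2s-2), while the upper bound is
   2 s^(2s) s^2/(s^2-1) for n = s and of lower order for n < s, where
   n+1 <= s.  Hence both maxima are 2 s^(2s) (1 + O(1/s)). *)

Local Open Scope nat_scope.

Lemma geom_recl (q h : nat) :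
  \sum_(i < h.+2) q ^ i = 1 + q * \sum_(i < h.+1) q ^ i.
Proof.
rewrite big_ord_recl expn0 big_distrr; congr (_ + _).
by apply: eq_bigr => i _; rewrite expnS.
Qed.

(** The summand [(n + 1) * m] turns the base value m (n+1) into 2 (n+1) m. Unrolling once replaces m
    by (m+h+1) n^2, and [geom_recl] absorbs this factor into the next geometric sum. *)
Lemma B_closed (m n h : nat) :
  B m n h + (n + 1) * m =
  2 * (n + 1) * (m * \sum_(i < h.+1) (n ^ 2) ^ i
    + \sum_(j < h.+1) j * \sum_(i < j.+1) (n ^ 2) ^ i).
Proof.
elim: h m => [|h IHh] m; first by rewrite !big_ord1 /=; lia.
have := IHh ((m + h.+1) * n ^ 2).
rewrite [\sum_(j < h.+2) j * _]big_ord_recr /= geom_recl.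
move: (B _ _ _) (\sum_(i < _) _) (\sum_(i < _) _) => b g S.
rewrite !expnS expn0 !muln1; lia.
Qed.

(** By [B_closed], the part of B depending on m is (n+1) m (2 g_h - 1), and g_h >= 1. *)
Lemma B0_leq (m n h : nat) : B 0 n h + m <= B m n h.
Proof.
have := B_closed m n h; have := B_closed 0 n h.
have : 0 < \sum_(i < h.+1) (n ^ 2) ^ i by rewrite big_ord_recl expn0.
move=> /(leq_mul (leqnn ((n + 1) * m))).
move: (\sum_(i < _) _) (\sum_(i < _) _) => g S; lia.
Qed.

Lemma B_lower (n h : nat) : 2 * (n + 1) * h * (n ^ 2) ^ h <= B 0 n h.
Proof.
have : (n ^ 2) ^ h <= \sum_(i < h.+1) (n ^ 2) ^ i.
  by rewrite big_ord_recr leq_addl.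
move=> /(leq_mul (leqnn (2 * (n + 1) * h))) /leq_trans; apply.
have := B_closed 0 n h; rewrite [\sum_(j < h.+1) j * _]big_ord_recr /=.
move: (\sum_(i < h.+1) _) (\sum_(i < h) _) => g S; nia.
Qed.

(** Telescoping: (q-1) j q^(j+1) = j q^(j+2) - j q^(j+1), and the increments of j only leave
    negative terms. *)
Lemma arith_geom_leq (q h : nat) : 0 < q ->
  q.-1 * \sum_(j < h.+1) j * q ^ j.+1 <= h * q ^ h.+2.
Proof.
move=> q_gt0; elim: h => [|h IHh]; first by rewrite big_ord1 muln0.
rewrite big_ord_recr /=; move: IHh; rewrite [q ^ h.+3]expnS.
move: (\sum_(i < _) _) (q ^ h.+2) => S p; case: q q_gt0 => // q _; nia.
Qed.

Lemma B_upper (m n h : nat) : 0 < n ->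
  (n ^ 2).-1 ^ 2 * B m n h <= 2 * (n + 1) * (m + h) * (n ^ 2) ^ h.+2.
Proof.
move=> n_gt0; set q := n ^ 2; have q_gt0 : 0 < q by rewrite expn_gt0 n_gt0.
have geom k : q.-1 * \sum_(i < k) q ^ i <= q ^ k.
  by rewrite -predn_exp leq_pred.
(* The inner factor q-1 clears each geometric sum, the outer one the sum over j. *)
have mom : q.-1 * (q.-1 * \sum_(j < h.+1) j * \sum_(i < j.+1) q ^ i)
    <= h * q ^ h.+2.
  apply: leq_trans (arith_geom_leq _ h q_gt0).
  rewrite leq_mul2l big_distrr /=; apply/orP; right; apply: leq_sum => j _.
  by rewrite mulnCA leq_mul2l geom orbT.
(* One factor q-1 clears the sum; the other is bounded by q to match the exponent in [mom]. *)
have lead : q.-1 * (q.-1 * \sum_(i < h.+1) q ^ i) <= q ^ h.+2.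
  by rewrite [q ^ h.+2]expnS leq_mul ?leq_pred.
have le_B : B m n h <= 2 * (n + 1) * (m * \sum_(i < h.+1) q ^ i
    + \sum_(j < h.+1) j * \sum_(i < j.+1) q ^ i).
  by rewrite -B_closed leq_addr.
apply: leq_trans (leq_mul (leqnn _) le_B) _.
rewrite mulnCA -[X in _ <= X]mulnA leq_mul2l; apply/orP; right.
have := leq_mul (leqnn m) lead; rewrite -mulnn; move: mom.
move: (\sum_(i < _) _) (\sum_(i < _) _) => g S; lia.
Qed.

Lemma B_max (s n h : nat) : 1 < s -> n <= s -> h < n ->
  (s ^ 2).-1 * B (s - n) n h <= 2 * s ^ (2 * s) * s ^ 2.
Proof.
move=> s_gt1 le_ns lt_hn; have n_gt0 : 0 < n by lia.
have pow : (n ^ 2) ^ h.+2 <= n ^ 2 * n ^ (2 * n).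
  rewrite -expnD -expnM leq_pexp2l //; lia.
have le_B : (n ^ 2).-1 ^ 2 * B (s - n) n h
    <= 2 * (n + 1) * s.-1 * (n ^ 2 * n ^ (2 * n)).
  apply: leq_trans (B_upper _ _ _ n_gt0) _.
  by rewrite leq_mul // leq_mul2l; apply/orP; right; lia.
case: (eqVneq n s) le_B => [->|ne_ns] le_B.
  have sq_gt0 : 0 < (s ^ 2).-1 by nia.
  rewrite -(leq_pmul2l sq_gt0) mulnA mulnn.
  apply: leq_trans le_B _; apply: eq_leq.
  (* For n = s one factor s^2-1 cancels exactly against the coefficient (n+1)(s-1). *)
  have -> : (s ^ 2).-1 = (s + 1) * s.-1 by nia.
  move: (s ^ 2) (s ^ (2 * s)); lia.
have lt_ns : n < s by lia.
(* For n < s there is room to spare: B <= 2 s^(2s) is enough. *)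
rewrite [_ * s ^ 2]mulnC; apply: leq_mul; first exact: leq_pred.
(* At n = 1 the factor n^2-1 vanishes and [le_B] says nothing, but then h = 0 and B is 2 (s-1). *)
have [n_gt1|n_le1] := ltnP 1 n; last first.
  have [-> ->] : n = 1 /\ h = 0 by lia.
  have : s ^ 2 <= s ^ (2 * s) by rewrite leq_pexp2l //; lia.
  rewrite /=; nia.
have sq : n ^ 2 * n ^ 2 <= 2 * (n ^ 2).-1 ^ 2.
  have : 4 <= n ^ 2 by nia.
  case: (n ^ 2) => // q; rewrite -mulnn /=; nia.
(* Since n <= s-1, four powers of s are saved; they absorb 2 (n+1)(s-1) in [lin]. *)
have pown : n ^ (2 * n) <= n ^ 2 * s ^ (2 * s - 4).
  have -> : 2 * n = 2 + (2 * n - 2) by lia.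
  rewrite expnD leq_mul2l; apply/orP; right.
  apply: (@leq_trans (s ^ (2 * n - 2))); first by rewrite leq_exp2r; lia.
  by rewrite leq_pexp2l; lia.
have n4_gt0 : 0 < n ^ 2 * n ^ 2 by nia.
have -> : 2 * s = 4 + (2 * s - 4) by lia.
rewrite expnD -(leq_pmul2l n4_gt0).
apply: leq_trans (leq_mul sq (leqnn _)) _.
rewrite -mulnA.
apply: leq_trans (leq_mul (leqnn 2) le_B) _.
have lin : 2 * (n + 1) * s.-1 <= s ^ 4.
  have : (n + 1) * s.-1 <= s * s by apply: leq_mul; lia.
  have : 4 <= s * s by nia.
  rewrite !expnS expn0; nia.
have := leq_mul lin (leq_mul (leqnn (n ^ 2)) pown).
move: (2 * (n + 1) * s.-1) (n ^ 2) (n ^ _) (s ^ 4) (s ^ _); lia.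
Qed.

(** Lets the lower bound for [C0] and the upper bound for [C] serve both limits. *)
Lemma leq_C0_C (s : nat) : C0 s <= C s.
Proof.
apply/bigmax_leqP => n _; apply/bigmax_leqP => h _.
apply: leq_trans (leq_bigmax n); apply: leq_trans (leq_bigmax h).
by rewrite leq_add2r B0_leq.
Qed.

Lemma C0_lower (s : nat) : 1 < s -> 2 * s ^ (2 * s) * s <= s.+1 * C0 s.
Proof.
move=> s_gt1.
have h_lt : s.-1 < s by lia.
have le_C0 : B 0 s s.-1 <= C0 s.
  apply: leq_trans (leq_bigmax ord_max).
  by apply: leq_trans (leq_bigmax (Ordinal h_lt)); rewrite /= -addnA leq_addr.
apply: leq_trans (leq_mul (leqnn _) (leq_trans (B_lower _ _) le_C0)).
have -> : s ^ (2 * s) = s ^ 2 * (s ^ 2) ^ s.-1.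
  by rewrite -expnM -expnD; congr (_ ^ _); lia.
move: ((s ^ 2) ^ s.-1) => p.
(* (s+1)^2 (s-1) = s^3 + s^2 - s - 1, and s >= 2. *)
have : s ^ 2 * s <= s.+1 * ((s + 1) * s.-1) by nia.
move=> /leq_mul/(_ (leqnn (2 * p))); move: (s ^ 2); lia.
Qed.

Lemma C_upper (s : nat) : 1 < s -> s.+1 * C s <= 2 * s ^ (2 * s) * (s + 3).
Proof.
move=> s_gt1; rewrite mulnC -leq_divRL //.
apply/bigmax_leqP => n _; apply/bigmax_leqP => h _; rewrite leq_divRL //.
have le_ns : n <= s by rewrite -ltnS.
have s1_gt0 : 0 < s.-1 by lia.
rewrite -(leq_pmul2l s1_gt0).
have := B_max _ _ _ s_gt1 le_ns (ltn_ord h).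
(* Since (s-1)(s+3) = s^2 + 2s - 3 exceeds s^2, the surplus over [B_max] absorbs the extra (s^2-1) h
   <= s^3. *)
have : s ^ 3 <= s ^ (2 * s) by rewrite leq_pexp2l; lia.
have := ltn_ord h.
move: (nat_of_ord h) (s ^ (2 * s)) (B _ _ _) => k p b lt_kn.
nia.
Qed.

Local Close Scope nat_scope.
Local Open Scope classical_set_scope.
Local Open Scope ring_scope.

(** The denominator s+1 is that of [harmonic]: the ratio lies between 1 - 1/(s+1) and 1 +
    2/(s+1). *)
Lemma cvg_ratio_squeeze (R : realType) (f : nat -> nat) :
  (forall s, (1 < s)%N ->
    (2 * s ^ (2 * s) * s <= s.+1 * f s <= 2 * s ^ (2 * s) * (s + 3))%N) ->
  ((f s)%:R / (2 * s%:R ^+ (2 * s)) : R) @[s --> \oo] --> (1 : R).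
Proof.
move=> f_bounds.
have harm0 : (@harmonic R) @ \oo --> (0 : R) by exact: cvg_harmonic.
have lo1 : (1 - @harmonic R s) @[s --> \oo] --> (1 : R).
  by rewrite -[X in _ --> X]subr0; apply: cvgB => //; exact: cvg_cst.
have up1 : (1 + 2 * @harmonic R s) @[s --> \oo] --> (1 : R).
  rewrite -[X in _ --> X]addr0 -[X in _ + X](mulr0 2).
  by apply: cvgD; [exact: cvg_cst | apply: cvgM => //; exact: cvg_cst].
apply: (squeeze_cvgr _ lo1 up1).
near=> s.
have s_gt1 : (1 < s)%N by near: s; exact: nbhs_infty_gt.
have /andP[lo up] := f_bounds s s_gt1.
have p_gt0 : 0 < 2 * s%:R ^+ (2 * s) :> R.
  by rewrite mulr_gt0 // exprn_gt0 // ltr0n; lia.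
have s1_gt0 : 0 < s.+1%:R :> R by rewrite ltr0n.
move: lo up; rewrite -!(ler_nat R) !natrM !natrX natrD.
move: p_gt0; move: (2 * s%:R ^+ (2 * s)) => p p_gt0 lo up.
rewrite /harmonic ler_pdivlMr // ler_pdivrMr //.
have -> : 1 - s.+1%:R^-1 = s%:R / s.+1%:R :> R.
  by field; rewrite ?mulrS; lra.
have -> : 1 + 2 * s.+1%:R^-1 = (s%:R + 3) / s.+1%:R :> R.
  by field; rewrite ?mulrS; lra.
rewrite [s%:R / _ * _]mulrAC [(s%:R + 3) / _ * _]mulrAC.
rewrite ler_pdivrMr // ler_pdivlMr //.
by apply/andP; split; lra.
Unshelve. all: by end_near. Qed.

Theorem mainTheorem3 (R : realType) :
  ((C s)%:R / (2 * s%:R ^+ (2 * s)) : R) @[s --> \oo] --> (1 : R) /\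
  ((C0 s)%:R / (2 * s%:R ^+ (2 * s)) : R) @[s --> \oo] --> (1 : R).
Proof.
split; apply: cvg_ratio_squeeze => s s_gt1; apply/andP; split.
- by apply: leq_trans (C0_lower _ s_gt1) _; rewrite leq_mul2l leq_C0_C orbT.
- exact: C_upper.
- exact: C0_lower.
- by apply: leq_trans (C_upper _ s_gt1); rewrite leq_mul2l leq_C0_C orbT.
Qed.
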